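(* For every $x \in (-\pi/2, \pi/2)$, we have \[ \int_0^x \sec^2(t)\,dt = \tan(x). \] For all real $a, b$ with $0 < a < b < \pi$, we have \[ \int_a^b \csc^2(t)\,dt = \cot(a) - \cot(b). \]
   Context: Integrals are Riemann integrals, with the convention $\int_0^x = -\int_x^0$ when $x < 0$ and $\int_0^0 = 0$. Here $\sec = 1/\cos$, $\csc = 1/\sin$, $\cot = \cos/\sin$. *)

(* Defs.v *)
From Stdlib Require Import Reals.
Open Scope R_scope.

Definition sec (x : R) : R := 1 / cos x.

Definition csc (x : R) : R := 1 / sin x.

Definition cot (x : R) : R := cos x / sin x.

(* Main.v *)
Require Import Defs.
From Stdlib Require Import Reals Lra.
From Coquelicot Require Import Coquelicot.
Open Scope R_scope.

(** Both integrals come from the fundamental theorem of calculus ([is_RInt_derive]), with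
    antiderivatives [tan] and [- cot]. It needs the derivative formula and continuity of the
    integrand on the closed interval, hence that [cos], respectively [sin], has no zero there. *)

Lemma is_derive_tan (x : R) : cos x <> 0 -> is_derive tan x (sec x ^ 2).
Proof.
intros Hx; unfold tan, sec.
auto_derive; [exact Hx|].
(* The quotient rule leaves this numerator, which the Pythagorean identity turns into 1. *)
transitivity ((Rsqr (sin x) + Rsqr (cos x)) / cos x ^ 2).
- unfold Rsqr; field; exact Hx.
- rewrite sin2_cos2; field; exact Hx.
Qed.

Lemma is_derive_opp_cot (x : R) :
  sin x <> 0 -> is_derive (fun t => - cot t) x (csc x ^ 2).
Proof.
intros Hx; unfold cot, csc.
auto_derive; [exact Hx|].
transitivity ((Rsqr (sin x) + Rsqr (cos x)) / sin x ^ 2).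
- unfold Rsqr; field; exact Hx.
- rewrite sin2_cos2; field; exact Hx.
Qed.

(** Differentiability gives continuity. *)
Lemma continuous_sec_sqr (x : R) :
  cos x <> 0 -> continuous (fun t => sec t ^ 2) x.
Proof.
intros Hx; apply (ex_derive_continuous (fun t => sec t ^ 2)).
unfold sec; auto_derive; exact Hx.
Qed.

Lemma continuous_csc_sqr (x : R) :
  sin x <> 0 -> continuous (fun t => csc t ^ 2) x.
Proof.
intros Hx; apply (ex_derive_continuous (fun t => csc t ^ 2)).
unfold csc; auto_derive; exact Hx.
Qed.

Theorem theorem3p12 :
  (forall x : R, - PI / 2 < x < PI / 2 ->
     is_RInt (fun t : R => sec t ^ 2) 0 x (tan x)) /\
  (forall a b : R, 0 < a -> a < b -> b < PI ->
     is_RInt (fun t : R => csc t ^ 2) a b (cot a - cot b)).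
Proof.
split.
- intros x Hx.
  assert (Hcos : forall t, Rmin 0 x <= t <= Rmax 0 x -> cos t <> 0).
  (* For either sign of [x], the segment between 0 and [x] stays inside (-π/2, π/2), where [cos] is
     positive. *)
  { intros t; unfold Rmin, Rmax; destruct (Rle_dec 0 x); intros Ht;
      apply Rgt_not_eq, cos_gt_0; lra. }
  replace (tan x) with (minus (tan x) (tan 0))
    by (rewrite tan_0; apply Rminus_0_r).
  apply (is_RInt_derive tan (fun t => sec t ^ 2)); intros t Ht.
  + apply is_derive_tan, Hcos, Ht.
  + apply continuous_sec_sqr, Hcos, Ht.
- intros a b Ha Hab Hb.
  assert (Hsin : forall t, Rmin a b <= t <= Rmax a b -> sin t <> 0).
  { intros t; rewrite Rmin_left, Rmax_right by lra; intros Ht.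
    apply Rgt_not_eq, sin_gt_0; lra. }
  (* Recast as the increment of the antiderivative [- cot] from [a] to [b]. *)
  replace (cot a - cot b) with (minus (- cot b) (- cot a))
    by (unfold minus, plus, opp; simpl; ring).
  apply (is_RInt_derive (fun t => - cot t) (fun t => csc t ^ 2)); intros t Ht.
  + apply is_derive_opp_cot, Hsin, Ht.
  + apply continuous_csc_sqr, Hsin, Ht.
Qed.
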